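(* Let $K$ be a field and $n\geq 0$. A polynomial $p(x)\in K[x]$ of degree $n$ is multiplicatively symmetric if and only if there is an additively symmetric polynomial $q(x)\in K[x]$ of degree $n$ satisfying $$ p(x)=x^{\frac{n}{2}} \left(q(\sqrt{x})+q\left(\frac{1}{\sqrt{x}}\right)-q(0)\right). $$ Moreover, $q(x)$ is uniquely determined.
   Context: A polynomial $p(x)\in K[x]$ of degree $n$ is multiplicatively symmetric if $x^np(x^{-1})=p(x)$, and additively symmetric if $p(x)=(-1)^np(-x)$. The displayed identity is an identity of Laurent polynomials in $\sqrt{x}$. *)

(* Defs.v *)
From HB Require Import structures.
From mathcomp Require Import all_boot all_order all_algebra.

Set Implicit Arguments.
Unset Strict Implicit.
Unset Printing Implicit Defensive.

Import GRing.Theory.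
Local Open Scope ring_scope.

(* Laurent polynomials over K are handled inside the field of rational
   functions {fraction {poly K}}, which contains K[t, t^-1]. *)
Section Symmetric.
Variable K : fieldType.
Implicit Types p q : {poly K}.

Definition indet : {fraction {poly K}} := tofrac 'X.

Definition constfrac (c : K) : {fraction {poly K}} := tofrac c%:P.

Definition evalfrac p (y : {fraction {poly K}}) : {fraction {poly K}} :=
  (map_poly constfrac p).[y].

(* The degree is (size p).-1; it is only meaningful for p != 0. *)
Definition multiplicatively_symmetric p : Prop :=
  indet ^+ (size p).-1 * evalfrac p indet^-1 = evalfrac p indet.

Definition additively_symmetric p : Prop :=
  p = (-1) ^+ (size p).-1 *: (p \Po - 'X).

(* p(x) = x^(n/2) (q(sqrt x) + q(1 / sqrt x) - q(0)).  The indeterminate t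
   plays the role of sqrt x, so that x = t^2 and x^(n/2) = t^n. *)
Definition symmetrization (n : nat) p q : Prop :=
  let t := indet in
  evalfrac p (t ^+ 2) =
    t ^+ n * (evalfrac q t + evalfrac q t^-1 - constfrac q.[0]).

End Symmetric.

(* Main.v *)
(** Put [t = sqrt x] and [q = sum_i q_i x^i].  The right-hand side is
    [t^n (q_0 + sum_(i > 0) q_i (t^i + t^-i))], so that the identity says that
    [q_i] is the coefficient of both [t^(n+i)] and [t^(n-i)] in [p(t^2)].
    Hence [q] is determined by [p], in every characteristic, and it exists
    exactly when the coefficients of [p] are palindromic; it is additively
    symmetric because [p(t^2)] has no odd coefficient. *)
Require Import Defs.
From HB Require Import structures.
From mathcomp Require Import all_boot all_order all_algebra.
From mathcomp Require Import zify.
Import GRing.Theory.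
Local Open Scope ring_scope.

HB.instance Definition _ (K : fieldType) :=
  GRing.RMorphism.copy (@constfrac K) (@tofrac {poly K} \o polyC).

(** The reciprocal polynomial [x^n q(1/x)], taken with respect to a fixed [n] instead of the degree
    of [q]. *)
Definition palindrome {K : fieldType} (n : nat) (q : {poly K}) : {poly K} :=
  \poly_(i < n.+1) q`_(n - i).

Lemma indet_neq0 (K : fieldType) : indet K != 0.
Proof. by rewrite tofrac_eq0 polyX_eq0. Qed.

Lemma evalfrac_tofrac (K : fieldType) (p r : {poly K}) :
  evalfrac p (tofrac r) = tofrac (p \Po r).
Proof.
by rewrite /evalfrac (map_poly_comp (@tofrac {poly K}) polyC) horner_map.
Qed.

(** Clears denominators: after multiplication by [t^n] both identities of the theorem live in
    [K[t]], where coefficients can be compared. *)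
Lemma evalfrac_indetV (K : fieldType) (n : nat) (q : {poly K}) :
  (size q <= n.+1)%N ->
  indet K ^+ n * evalfrac q (indet K)^-1 = tofrac (palindrome n q).
Proof.
move=> sq; rewrite /evalfrac (@horner_coef_wide _ n.+1); last first.
  by rewrite size_map_poly.
rewrite mulr_sumr /palindrome poly_def raddf_sum (reindex_inj rev_ord_inj) /=.
apply: eq_bigr => i _.
rewrite coef_map /= -mul_polyC rmorphM rmorphXn /= subSS mulrCA; congr (_ * _).
have le_in : (i <= n)%N by rewrite -ltnS.
by rewrite exprVn -{1}(subnKC le_in) exprD mulfK // expf_neq0 ?indet_neq0.
Qed.

Lemma multiplicatively_symmetricP {K : fieldType} {n : nat} {p : {poly K}} :
  size p = n.+1 ->
  (multiplicatively_symmetric p <->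
   forall i, (i <= n)%N -> p`_(n - i) = p`_i).
Proof.
move=> hp; rewrite /multiplicatively_symmetric hp /= evalfrac_indetV ?hp //.
rewrite evalfrac_tofrac comp_polyXr; split => [/eqP|sym].
  rewrite tofrac_eq => /eqP/polyP e i le_in.
  by have := e i; rewrite coef_poly ltnS le_in.
congr (tofrac _); apply/polyP => i; rewrite coef_poly ltnS.
by case: leqP => [/sym //|lt_ni]; rewrite nth_default ?hp.
Qed.

(** Passing from [q(x)] to [(-1)^n q(-x)] multiplies the coefficient [q_i] by [(-1)^(n+i)]. The
    converse fails in characteristic 2, where every [q] is additively symmetric. *)
Lemma additively_symmetric_parity {K : fieldType} {n : nat} {q : {poly K}} :
  size q = n.+1 ->
  (forall i, odd (n + i) -> q`_i = 0) -> additively_symmetric q.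
Proof.
move=> hq q0; apply/polyP => i; rewrite hq coefZ /=.
have -> : (q \Po - 'X)`_i = (-1) ^+ i * q`_i.
  rewrite comp_polyE -scaleN1r.
  under eq_bigr => j _ do rewrite exprZn scalerA mulrC.
  rewrite -(poly_def _ (fun j => (-1) ^+ j * q`_j)) coef_poly.
  case: ltnP => // le_qi; by rewrite nth_default // mulr0.
rewrite mulrA -exprD -signr_odd.
by case: (boolP (odd (n + i))) => [/q0->|]; rewrite ?mulr0 ?mul1r.
Qed.

(** The summand [t^n q(t)] fills the exponents from [n] upwards, and [t^n q(1/t)] those from [n]
    downwards. They meet only at [n], where subtracting [q(0)] removes the double count. *)
Lemma symmetrizationP {K : fieldType} {n : nat} {p q : {poly K}} :
  size p = n.+1 -> (size q <= n.+1)%N ->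
  (symmetrization n p q <->
   forall i, (i <= n)%N ->
     q`_i = (p \Po 'X^2)`_(n + i) /\ q`_i = (p \Po 'X^2)`_(n - i)).
Proof.
move=> hp sq.
have -> : symmetrization n p q <->
    p \Po 'X^2 = 'X^n * q + palindrome n q - 'X^n * q.[0]%:P.
  rewrite /symmetrization mulrBr mulrDr evalfrac_indetV // /indet -!rmorphXn /=.
  rewrite !evalfrac_tofrac comp_polyXr /constfrac -!rmorphM -rmorphD -rmorphB.
  by split => [/eqP|->] //; rewrite tofrac_eq => /eqP.
rewrite horner_coef0; split => [-> i le_in|e].
  rewrite !coefB !coefD !coefXnM !coefC !coef_poly.
  have [-> | i_gt0] := posnP i.
    by rewrite addn0 subn0 ltnn ltnSn subnn eqxx addrK.
  split.
    rewrite addKn ltnNge leq_addr /= ltnS leqNgt -{1}(addn0 n) ltn_add2l i_gt0 /=.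
    by rewrite -(subnKC i_gt0) subr0 addr0.
  rewrite ltn_subrL i_gt0 (leq_trans i_gt0 le_in) /= ltnS leq_subr subKn //.
  by rewrite subr0 add0r.
apply/polyP => k.
rewrite !coefB !coefD !coefXnM !coefC !coef_poly ltnS.
case: (ltngtP k n) => [lt_kn | lt_nk | ->].
- have [_] := e (n - k)%N (leq_subr _ _).
  by rewrite subKn ?(ltnW lt_kn) // => <-; rewrite subr0 add0r.
- rewrite subn_eq0 leqNgt lt_nk /= subr0 addr0.
  have [le_k | lt_k] := leqP (k - n) n.
    by have [-> _] := e _ le_k; rewrite subnKC // ltnW.
  (* Beyond exponent [2n] both sides vanish, by the size bounds on [q] and [p]. *)
  rewrite [RHS]nth_default ?(leq_trans sq) //.
  rewrite coef_comp_poly_Xn //; case: ifP => // /dvdnP[m def_k].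
  rewrite def_k mulnK // nth_default // hp; lia.
- have [] := e 0%N isT; rewrite addn0 => <- _ //.
  by rewrite subnn eqxx addrK.
Qed.

Theorem theorem2p4 (K : fieldType) (n : nat) (p : {poly K})
    (hp : size p = n.+1) :
  (multiplicatively_symmetric p <->
   exists q : {poly K},
     [/\ size q = n.+1, additively_symmetric q & symmetrization n p q])
  /\
  (forall q1 q2 : {poly K},
     [/\ size q1 = n.+1, additively_symmetric q1 & symmetrization n p q1] ->
     [/\ size q2 = n.+1, additively_symmetric q2 & symmetrization n p q2] ->
     q1 = q2).
Proof.
have psq_even k : (p \Po 'X^2)`_(k + k) = p`_k.
  by rewrite coef_comp_poly_Xn // addnn -muln2 dvdn_mull // mulnK.
have psq_odd k : odd k -> (p \Po 'X^2)`_k = 0.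
  by move=> odd_k; rewrite coef_comp_poly_Xn // dvdn2 odd_k.
split; last first.
  move=> q1 q2 [s1 _ /(symmetrizationP hp) sym1].
  move=> [s2 _ /(symmetrizationP hp) sym2].
  rewrite s1 in sym1; rewrite s2 in sym2.
  move: sym1 sym2 => /(_ (leqnn _)) sym1 /(_ (leqnn _)) sym2.
  apply/polyP => i; have [le_in | lt_ni] := leqP i n.
    by rewrite (sym1 _ le_in).1 (sym2 _ le_in).1.
  by rewrite !nth_default ?s1 ?s2.
split=> [/(multiplicatively_symmetricP hp) sym | [q [sq _ /symmetrizationP]]].
  (* The choice forced by [symmetrizationP]: the upper half of [p(t^2)]. *)
  pose q := \poly_(i < n.+1) (p \Po 'X^2)`_(n + i).
  (* The top coefficient of [q] sits at [t^(2n)] in [p(t^2)], so it is the leading coefficient of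
     [p]. *)
  have sq : size q = n.+1.
    by rewrite size_poly_eq // psq_even -[n]/(n.+1.-1) -hp -lead_coefE
      lead_coef_eq0 -size_poly_eq0 hp.
  have q_coef i : (i <= n)%N -> q`_i = (p \Po 'X^2)`_(n + i).
    by move=> le_in; rewrite coef_poly ltnS le_in.
  exists q; split => //.
    apply: additively_symmetric_parity sq _ => i odd_i.
    by rewrite coef_poly psq_odd // if_same.
  apply/symmetrizationP => //; first by rewrite sq.
  move=> i le_in; rewrite q_coef //; split=> //.
  have [odd_ni | even_ni] := boolP (odd (n + i)).
    by rewrite !psq_odd // oddB // -oddD.
  (* With [m = (n + i)/2] the two exponents are [2m] and [2(n - m)], and [p_m = p_(n-m)]. *)
  have -> : (n + i = (n + i)./2 + (n + i)./2)%N by lia.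
  have -> : (n - i = (n - (n + i)./2) + (n - (n + i)./2))%N by lia.
  rewrite !psq_even sym //; lia.
rewrite sq => /(_ hp (leqnn _)) sym.
apply/(multiplicatively_symmetricP hp) => k le_kn.
(* The exponents [2k] and [2(n - k)] lie at the same distance from [n]; this distance, [n - 2k] or
   [2k - n], is the index at which [sym] is applied. *)
rewrite -!psq_even; have [le_kk | /ltnW le_nkk] := leqP (k + k) n.
  have [eD eB] := sym _ (leq_subr (k + k) n).
  rewrite subKn // in eB; rewrite -eB eD; congr (_`_ _); lia.
have le_kkn : (k + k - n <= n)%N by lia.
have [eD eB] := sym _ le_kkn.
rewrite subnKC // in eD; rewrite -eD eB; congr (_`_ _); lia.
Qed.
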